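(* There exists a constant $c>0$ such that, given an integer $n$, one can construct deterministically, in running time polynomial in $n$, a cover of the matrix $C_n\otimes C_n$ by at most $c\cdot k\log_2 k$ monochromatic all-ones combinatorial rectangles, where $k=\mathrm{R}_{\mathbb{B}}(C_n)$.
   Context: $C_n$ is the $n\times n$ $0,1$-matrix with zeros on the diagonal and ones elsewhere. A combinatorial rectangle of a matrix is a set $X\times Y$ of (row, column) index pairs; it is monochromatic all-ones if all entries there equal $1$; a cover of a $0,1$-matrix by such rectangles is a collection whose union is exactly the set of $1$-entries. The Boolean rank $\mathrm{R}_{\mathbb{B}}(A)$ is the minimum size of such a cover of $A$. The Kronecker product $A\otimes B$ is the block matrix with $(i,j)$-th block $A_{i,j}B$. *)

(* Defs.v *)
From HB Require Import structures.
From mathcomp Require Import all_boot all_order all_algebra.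
From mathcomp Require Export mxtens.
From mathcomp Require Import reals exp.

Set Implicit Arguments.
Unset Strict Implicit.
Unset Printing Implicit Defensive.

Import GRing.Theory.

(** * Rectangle covers and Boolean rank *)

(* A combinatorial rectangle X * Y is kept as the pair (X, Y). *)
Definition rectangle (m n : nat) : finType := ({set 'I_m} * {set 'I_n})%type.

Definition cells (m n : nat) (r : rectangle m n) : {set 'I_m * 'I_n} :=
  setX r.1 r.2.

(* 0,1-matrices are integer matrices, so that the Kronecker product is the
   library's [tensmx] (notation [A *t B]), for which row (i, i') has index
   i * p + i', p being the number of rows of B. *)
Definition ones (m n : nat) (A : 'M[int]_(m, n)) : {set 'I_m * 'I_n} :=
  [set ij | A ij.1 ij.2 == 1%R].

Definition all_ones (m n : nat) (A : 'M[int]_(m, n)) (r : rectangle m n) : bool :=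
  [forall ij in cells r, A ij.1 ij.2 == 1%R].

Definition is_cover (m n : nat) (A : 'M[int]_(m, n)) (s : seq (rectangle m n)) :
    bool :=
  all (all_ones A) s && (\bigcup_(r <- s) cells r == ones A).

Lemma has_cover (m n : nat) (A : 'M[int]_(m, n)) :
  exists k, [exists s : k.-tuple (rectangle m n), is_cover A s].
Proof.
pose s : seq (rectangle m n) := [seq ([set ij.1], [set ij.2]) | ij <- enum (ones A)].
exists (size s); apply/existsP; exists (in_tuple s).
apply/andP; split.
- apply/allP => _ /mapP[[i j] + ->]; rewrite mem_enum inE /= => Aij.
  by apply/forall_inP => -[i' j']; rewrite !inE /= => /andP[/eqP-> /eqP->].
apply/eqP/setP => -[i j]; rewrite /= big_map big_enum /=.
apply/bigcupP/idP => [[[i' j'] Aij]|Aij].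
  by rewrite !inE /= => /andP[/eqP-> /eqP->]; rewrite inE in Aij.
by exists (i, j); rewrite // !inE /= !eqxx.
Qed.

Definition boolean_rank (m n : nat) (A : 'M[int]_(m, n)) : nat :=
  ex_minn (has_cover A).

Definition Cmx (n : nat) : 'M[int]_n := (\matrix_(i, j) (i != j)%:R)%R.

Definition log2 (R : realType) (x : R) : R := (ln x / ln 2)%R.

(** * Deterministic random access machines *)

(* A RAM in the style of Cook and Reckhow, with structured control flow:
   finitely many registers (those named by the program), an unbounded memory
   with indirect addressing, and a write-only output tape. The arithmetic is
   limited to addition and truncated subtraction, so that bit lengths grow by at
   most one per unit of time; hence unit-cost time is polynomially related to
   Turing machine time. *)
Inductive expr :=
| Const of nat
| Reg of nat
| Mem of expr
| Add of expr & expr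
| Sub of expr & expr.

Inductive cmd :=
| Skip
| Set_ of nat & expr
| Store of expr & expr
| Print of expr
| Seq of cmd & cmd
| If of expr & cmd & cmd
| While of expr & cmd.

Record state := State {
  regs : nat -> nat;
  memory : nat -> nat;
  output : seq nat
}.

Definition upd (f : nat -> nat) (a v : nat) : nat -> nat :=
  fun x => if x == a then v else f x.

Fixpoint eval (s : state) (e : expr) : nat :=
  match e with
  | Const c => c
  | Reg x => regs s x
  | Mem e1 => memory s (eval s e1)
  | Add e1 e2 => eval s e1 + eval s e2
  | Sub e1 e2 => eval s e1 - eval s e2
  end.

Fixpoint ecost (e : expr) : nat :=
  match e with
  | Const _ | Reg _ => 1
  | Mem e1 => (ecost e1).+1
  | Add e1 e2 | Sub e1 e2 => (ecost e1 + ecost e2).+1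
  end.

(* [exec p s t s']: started in state s, p halts in state s' after t time units.
   Tests succeed on nonzero values. *)
Inductive exec : cmd -> state -> nat -> state -> Prop :=
| ExecSkip s :
    exec Skip s 1 s
| ExecSet s x e :
    exec (Set_ x e) s (ecost e).+1
      (State (upd (regs s) x (eval s e)) (memory s) (output s))
| ExecStore s a e :
    exec (Store a e) s (ecost a + ecost e).+1
      (State (regs s) (upd (memory s) (eval s a) (eval s e)) (output s))
| ExecPrint s e :
    exec (Print e) s (ecost e).+1
      (State (regs s) (memory s) (rcons (output s) (eval s e)))
| ExecSeq p q s t s' t' s'' :
    exec p s t s' -> exec q s' t' s'' -> exec (Seq p q) s (t + t') s''
| ExecIfT e p q s t s' :
    eval s e != 0 -> exec p s t s' -> exec (If e p q) s (ecost e + t).+1 s'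
| ExecIfF e p q s t s' :
    eval s e = 0 -> exec q s t s' -> exec (If e p q) s (ecost e + t).+1 s'
| ExecWhileT e p s t s' t' s'' :
    eval s e != 0 -> exec p s t s' -> exec (While e p) s' t' s'' ->
    exec (While e p) s (ecost e + t + t').+1 s''
| ExecWhileF e p s :
    eval s e = 0 -> exec (While e p) s (ecost e).+1 s.

Lemma exec_det p s t1 s1 t2 s2 :
  exec p s t1 s1 -> exec p s t2 s2 -> t1 = t2 /\ s1 = s2.
Proof.
move=> H; elim: H t2 s2 => {p s t1 s1}.
- by move=> s t2 s2 H; inversion H.
- by move=> s x e t2 s2 H; inversion H.
- by move=> s a e t2 s2 H; inversion H.
- by move=> s e t2 s2 H; inversion H.
- move=> p q s t s' t' s'' _ IHp _ IHq t2 s2 H; inversion H; subst.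
  have [? ?] := IHp _ _ ltac:(eassumption); subst.
  by have [? ?] := IHq _ _ ltac:(eassumption); subst.
- move=> e p q s t s' e0 _ IH t2 s2 H; inversion H; subst.
    by have [? ?] := IH _ _ ltac:(eassumption); subst.
  by move/eqP: e0.
- move=> e p q s t s' e0 _ IH t2 s2 H; inversion H; subst.
    by match goal with H : is_true (eval _ _ != 0) |- _ => rewrite e0 in H end.
  by have [? ?] := IH _ _ ltac:(eassumption); subst.
- move=> e p s t s' t' s'' e0 _ IHp _ IHw t2 s2 H; inversion H; subst.
    have [? ?] := IHp _ _ ltac:(eassumption); subst.
    by have [? ?] := IHw _ _ ltac:(eassumption); subst.
  by move/eqP: e0.
- move=> e p s e0 t2 s2 H; inversion H; subst => //.
  by match goal with H : is_true (eval _ _ != 0) |- _ => rewrite e0 in H end.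
Qed.

Definition init (n : nat) : state :=
  State (upd (fun=> 0) 0 n) (fun=> 0) [::].

(* Time is measured against n itself, not against its bit length. *)
Definition poly_time_computable (f : nat -> seq nat) : Prop :=
  exists (p : cmd) (q : {poly nat}), forall n : nat,
    exists (t : nat) (s : state),
      [/\ exec p (init n) t s, t <= q.[n]%R & output s = f n].

(* A set of indices is written as its characteristic 0,1-vector and a rectangle
   as the vector of X followed by that of Y; rectangles have a fixed length
   m + n, so for m + n > 0 the code of a list determines the list. *)
Definition encode_set (n : nat) (X : {set 'I_n}) : seq nat :=
  [seq nat_of_bool (i \in X) | i <- enum 'I_n].

Definition encode_cover (m n : nat) (s : seq (rectangle m n)) : seq nat :=
  flatten [seq encode_set r.1 ++ encode_set r.2 | r <- s].

(* Main.v *)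
Require Import Defs.
From mathcomp Require Import all_boot all_order all_algebra.
From mathcomp Require Import reals exp.
From mathcomp Require Import zify.

(** Let p run through the primes 2, 3, 5, ... until their product reaches n^2.
    If i <> j and i' <> j' are below n, these primes cannot all divide
    (i - j)(i' - j'), so some p separates both i from j and i' from j' modulo p;
    then i mod p and j mod p differ in a bit a, and i' mod p and j' mod p in a
    bit b. Hence the 4 (log p)^2 rectangles "bit a of i mod p is x, bit b of
    i' mod p is y; the opposite for j, j'" cover C_n (x) C_n. If k is the Boolean
    rank of C_n, then n <= 2^k since the k rectangles of a cover tell the rows
    apart. A weak Chebyshev bound, from the prime factorisation of the central
    binomial coefficient, shows that all the primes used are polynomial in k;
    since their product is about n^2, the sum of (log p)^2 is at most
    (max log p) (sum log p) = O(log k) O(k).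

    The rectangles are printed by an explicit program, in which all tests reduce
    to remainders computed by repeated subtraction. *)

Set Implicit Arguments.
Unset Strict Implicit.
Unset Printing Implicit Defensive.

(** * A weak Chebyshev bound *)

(** Pascal's rule splits the next central coefficient into two terms, each at least the current
    one. *)
Lemma expn2_le_central_bin m : 2 ^ m <= 'C(2 * m, m).
Proof.
elim: m => // m IH; have -> : 2 * m.+1 = (2 * m).+2 by lia.
have le1 : 'C(2 * m, m) <= 'C((2 * m).+1, m.+1) by rewrite binS leq_addl.
have le2 : 'C(2 * m, m) <= 'C((2 * m).+1, m) by exact: leq_bin2l.
by rewrite binS expnS; lia.
Qed.

(** By Legendre's formula the exponent of [p] is the sum over [k] of [2m %/ p^k - 2 (m %/ p^k)];
    each term is at most 1 and vanishes once [p^k > 2m]. *)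
Lemma leq_pfactor_central_bin p m :
  prime p -> 0 < m -> p ^ logn p 'C(2 * m, m) <= 2 * m.
Proof.
move=> pr_p m_gt0; have p_gt1 := prime_gt1 pr_p.
apply: leq_trans (trunc_logP p_gt1 _); last by lia.
rewrite leq_exp2l //.
have m_le : m <= 2 * m by lia.
have /(congr1 (logn p)) := bin_fact m_le.
have -> : 2 * m - m = m by lia.
rewrite !lognM ?muln_gt0 ?fact_gt0 ?bin_gt0 // !logn_fact //.
have -> : \sum_(1 <= k < m.+1) m %/ p ^ k = \sum_(1 <= k < (2 * m).+1) m %/ p ^ k.
  rewrite [RHS](big_cat_nat (n := m.+1)) //=.
  rewrite [X in _ = _ + X]big_nat [X in _ = _ + X]big1 ?addn0 // => k /andP[m_lt_k _].
  by rewrite divn_small // (leq_trans m_lt_k) // ltnW // ltn_expl.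
set B := logn _ _ => eqB.
(* The subtracted sum is added to both sides, to avoid truncated subtraction. *)
suff: B + \sum_(1 <= k < (2 * m).+1) 2 * (m %/ p ^ k)
    <= trunc_log p (2 * m) + \sum_(1 <= k < (2 * m).+1) 2 * (m %/ p ^ k).
  by rewrite leq_add2r.
rewrite -big_distrr /= mul2n -addnn eqB addnn -mul2n big_distrr /=.
apply: (@leq_trans (\sum_(1 <= k < (2 * m).+1) ((p ^ k <= 2 * m) + 2 * (m %/ p ^ k)))).
  apply: leq_sum => k _; have q_gt0 : 0 < p ^ k by rewrite expn_gt0 prime_gt0.
  case: (leqP (p ^ k) (2 * m)) => [_|/divn_small-> //].
  have := divn_eq m (p ^ k); have := ltn_pmod m q_gt0.
  move: (p ^ k) (m %/ p ^ k) (m %% p ^ k) q_gt0 => q d r q_gt0 lt_r ->.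
  by rewrite -ltnS ltn_divLR //; nia.
rewrite big_split /= leq_add2r.
apply: (@leq_trans (\sum_(1 <= k < (trunc_log p (2 * m)).+1) 1)); last first.
  by rewrite sum_nat_const_nat muln1 subn1.
have t_le : trunc_log p (2 * m) <= 2 * m.
  have [->|m2_gt0] := posnP (2 * m); first by rewrite trunc_log0.
  by apply: leq_trans (trunc_logP p_gt1 m2_gt0); apply/ltnW/ltn_expl.
rewrite (big_cat_nat (n := (trunc_log p (2 * m)).+1)) //=.
rewrite [X in _ + X <= _]big_nat [X in _ + X <= _]big1 ?addn0.
  by apply: leq_sum => k _; exact: leq_b1.
move=> k /andP[lt_k _]; apply/eqP; rewrite eqb0 -ltnNge.
apply: leq_trans (trunc_log_ltn _ p_gt1) _.
by rewrite leq_exp2l.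
Qed.

Definition primorial M := \prod_(2 <= q < M.+1 | prime q) q.

Lemma primorial_pi M : 2 ^ count prime (iota 0 M.+1) <= primorial M.
Proof.
rewrite /primorial; elim: M => [|[_|M IH]]; [by rewrite big_geq | by rewrite big_geq |].
rewrite big_mkcond big_nat_recr // -big_mkcond.
rewrite -[in leqLHS](addn1 M.+2) iotaD count_cat expnD [count _ (iota (0 + _) 1)]/= addn0.
apply: leq_mul; first by [].
by case: (prime M.+2).
Qed.

(** A small primorial leaves at most [t] primes up to [2m], and each contributes a factor of at most
    [2m] to the coefficient. *)
Lemma central_bin_primorial m t :
  0 < m -> primorial (2 * m) < 2 ^ t -> 'C(2 * m, m) <= (2 * m) ^ t.
Proof.
move=> m_gt0 lt_t; set C := 'C(_, _).
have C_gt0 : 0 < C by rewrite bin_gt0; lia.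
have le_pi : size (primes C) <= t.
  rewrite -(@leq_exp2l 2) //; apply: leq_trans (ltnW lt_t).
  apply: leq_trans (primorial_pi _); rewrite leq_exp2l // -size_filter.
  apply: uniq_leq_size; first exact: primes_uniq.
  move=> p; rewrite mem_primes mem_filter mem_iota /= => /and3P[pr_p _ p_dvd].
  rewrite pr_p add0n ltnS; have : p %| (2 * m)`!.
    by rewrite -(@bin_fact (2 * m) m) ?dvdn_mulr //; lia.
  move=> p_dvd_fact; rewrite leqNgt; apply/negP => lt_p.
  have := logn_fact (2 * m) pr_p; rewrite big_nat big1.
    by move/eqP; rewrite -leqn0 leqNgt logn_gt0 mem_primes pr_p fact_gt0 p_dvd_fact.
  move=> k /andP[k_gt0 _]; apply: divn_small; apply: leq_trans lt_p _.
  by rewrite -{1}(expn1 p) leq_exp2l // prime_gt1.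
apply: (@leq_trans ((2 * m) ^ size (primes C))); last by rewrite leq_pexp2l //; lia.
rewrite [leqLHS]prod_prime_decomp // prime_decompE big_map /=.
have : {subset primes C <= prime} by move=> p; rewrite mem_primes => /andP[].
elim: (primes C) => [|p s IH] sub; first by rewrite big_nil.
rewrite big_cons /= expnS leq_mul //.
  by apply: leq_pfactor_central_bin => //; apply: sub; rewrite mem_head.
by apply: IH => q sq; apply: sub; rewrite inE sq orbT.
Qed.

(* An s with 2 ^ (s - 1) > 2 * s * k: this contradicts
   2 ^ m <= 'C(2m, m) <= (2m) ^ (2k) at 2m = 2 ^ s. *)
Definition prime_exp (k : nat) : nat := 2 * up_log 2 k + 6.

Lemma primorial_ge k : 2 ^ (2 * k) <= primorial (2 ^ prime_exp k).
Proof.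
rewrite leqNgt; apply/negP; rewrite /prime_exp; set u := up_log 2 k.
have -> : 2 ^ (2 * u + 6) = 2 * 2 ^ (2 * u + 5) by rewrite -expnS addnS.
move=> /central_bin_primorial; rewrite expn_gt0 => /(_ isT).
move/(leq_trans (expn2_le_central_bin _)); rewrite -expnS -expnM leq_exp2l //.
rewrite -addnS expnD mulnC expnM [(2 ^ 2) ^ u]expnAC -mulnn.
have := up_logP k (isT : 1 < 2); rewrite -/u.
have : u < 2 ^ u by exact: ltn_expl.
(* With [k <= v] and [u < v], the inequality [32 v^2 <= (2u + 6) 2k] is impossible. *)
move: (2 ^ u) => v; rewrite -[2 ^ 5]/32; nia.
Qed.

(** Rounding the logarithm up at most doubles [k], whence the bound [64 (2k)^2]. *)
Lemma prime_exp_le k : 0 < k -> 2 ^ prime_exp k <= 256 * k ^ 2.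
Proof.
move=> k_gt0; rewrite /prime_exp expnD mulnC [2 * _]mulnC expnM.
have : 2 ^ up_log 2 k <= 2 * k.
  case: k k_gt0 => [|[|k]] // _; have := up_log_gtn (isT : 1 < 2) (isT : 1 < k.+2).
  have : 0 < up_log 2 k.+2 by rewrite up_log_gt0.
  by case: (up_log _ _) => // u _; rewrite expnS /=; lia.
by move: (2 ^ up_log 2 k) => v; rewrite -!mulnn -[2 ^ 6]/64; nia.
Qed.

(** * The selected primes and the rectangles *)

(** The printed output and the cover are nests of this one combinator, so that they can be compared
    loop by loop. *)
Definition catmap (T : Type) (f : nat -> seq T) (m : nat) : seq T :=
  flatten [seq f i | i <- iota 0 m].

Lemma catmap_nil (T : Type) m : catmap (fun=> [::] : seq T) m = [::].
Proof. by rewrite /catmap; elim: (iota _ _). Qed.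

(* The candidate primes are numbered i = p - 2, and [accum n i] is the product
   of the primes selected among 2, ..., i + 1. *)
Fixpoint accum (n i : nat) : nat :=
  if i is i1.+1 then
    if (accum n i1 < n * n) && prime i1.+2 then accum n i1 * i1.+2 else accum n i1
  else 1.

Definition selected (n i : nat) : bool := (accum n i < n * n) && prime i.+2.

(* At least 2 ^ prime_exp n, hence enough for the product to reach n ^ 2. *)
Definition candidates (n : nat) : nat := n * n * 256.

(* For w = 2 ^ a, [w <= x %% (w + w)] is bit a of x. *)
Definition matches (p w sign side i : nat) : bool :=
  ~~ odd ((w <= i %% p %% (w + w)) + sign + side).

(** Side 0 describes rows and side 1 columns: the signs are the bit values required of a row, and a
    column must have the opposite values. *)
Definition cell (p w w' sa sb side i j : nat) : bool :=
  matches p w sa side i && matches p w' sb side j.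

Definition rect_code (n p w w' sa sb : nat) : seq nat :=
  catmap (fun side => catmap (fun i => catmap (fun j =>
    [:: nat_of_bool (cell p w w' sa sb side i j)]) n) n) 2.

Definition prime_block (T : Type) (f : nat -> nat -> nat -> nat -> seq T) (p : nat) :
    seq T :=
  catmap (fun a => catmap (fun b => catmap (fun sa => catmap (fun sb =>
    f (2 ^ a) (2 ^ b) sa sb) 2) 2) (up_log 2 p)) (up_log 2 p).

Definition blocks (T : Type) (n : nat)
    (f : nat -> nat -> nat -> nat -> nat -> seq T) : seq T :=
  catmap (fun i => if selected n i then prime_block (f i.+2) i.+2 else [::])
    (candidates n).

(** * Time-bounded triples for register programs *)

Definition evl (l : seq nat) (e : expr) : nat :=
  eval (State (nth 0 l) (fun=> 0) [::]) e.

(* The memory is never written, so only the register list l and the output o are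
   tracked. *)
Definition tr (p : cmd) (l : seq nat) (T : nat) (l' o : seq nat) : Prop :=
  forall s, regs s =1 nth 0 l -> memory s =1 (fun=> 0) ->
  exists t s', [/\ exec p s t s', t <= T, regs s' =1 nth 0 l',
    memory s' =1 (fun=> 0) & output s' = output s ++ o].

Lemma eval_evl s l e :
  regs s =1 nth 0 l -> memory s =1 (fun=> 0) -> eval s e = evl l e.
Proof.
move=> rs ms; rewrite /evl; elim: e => //=.
- by move=> e1 IH1 e2 IH2; rewrite IH1 IH2.
- by move=> e1 IH1 e2 IH2; rewrite IH1 IH2.
Qed.

Lemma tr_le p l T T' l' o : tr p l T l' o -> T <= T' -> tr p l T' l' o.
Proof.
move=> H le_T s rs ms; have [t [s' [? le_t ? ? ?]]] := H s rs ms.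
by exists t, s'; split=> //; apply: leq_trans le_T.
Qed.

Lemma tr_skip l : tr Skip l 1 l [::].
Proof. by move=> s rs ms; exists 1, s; split; rewrite ?cats0 //; constructor. Qed.

Lemma tr_set x e l : tr (Set_ x e) l (ecost e).+1 (set_nth 0 l x (evl l e)) [::].
Proof.
move=> s rs ms; exists (ecost e).+1; eexists; split; first exact: ExecSet.
- by [].
- by move=> r /=; rewrite nth_set_nth /= /upd (eval_evl e rs ms) rs.
- by [].
- by rewrite /= cats0.
Qed.

Lemma tr_print e l : tr (Print e) l (ecost e).+1 l [:: evl l e].
Proof.
move=> s rs ms; exists (ecost e).+1; eexists; split; first exact: ExecPrint.
- by [].
- by [].
- by [].
- by rewrite /= (eval_evl e rs ms) cats1.
Qed.

Lemma tr_seq p q l T T' l1 l2 o1 o2 :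
  tr p l T l1 o1 -> tr q l1 T' l2 o2 -> tr (Seq p q) l (T + T') l2 (o1 ++ o2).
Proof.
move=> Hp Hq s rs ms; have [t [s1 [e1 le1 rs1 ms1 os1]]] := Hp s rs ms.
have [t' [s2 [e2 le2 rs2 ms2 os2]]] := Hq s1 rs1 ms1.
exists (t + t'), s2; split=> //; first exact: ExecSeq e1 e2.
- exact: leq_add.
- by rewrite os2 os1 catA.
Qed.

Lemma tr_seq0 p q l T T' l1 l2 o :
  tr p l T l1 [::] -> tr q l1 T' l2 o -> tr (Seq p q) l (T + T') l2 o.
Proof. exact: tr_seq. Qed.

Lemma tr_seqr0 p q l T T' l1 l2 o :
  tr p l T l1 o -> tr q l1 T' l2 [::] -> tr (Seq p q) l (T + T') l2 o.
Proof. by move=> Hp Hq; rewrite -[o]cats0; apply: tr_seq Hp Hq. Qed.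

Lemma tr_ifT e p q l T l' o :
  evl l e != 0 -> tr p l T l' o -> tr (If e p q) l (ecost e + T).+1 l' o.
Proof.
move=> e0 H s rs ms; have [t [s' [? le_t ? ? ?]]] := H s rs ms.
exists (ecost e + t).+1, s'; split=> //; last by rewrite ltnS leq_add2l.
by apply: ExecIfT => //; rewrite (eval_evl e rs ms).
Qed.

Lemma tr_ifF e p q l T l' o :
  evl l e = 0 -> tr q l T l' o -> tr (If e p q) l (ecost e + T).+1 l' o.
Proof.
move=> e0 H s rs ms; have [t [s' [? le_t ? ? ?]]] := H s rs ms.
exists (ecost e + t).+1, s'; split=> //; last by rewrite ltnS leq_add2l.
by apply: ExecIfF => //; rewrite (eval_evl e rs ms).
Qed.

(** [L i] is the register file after [i] rounds; it plays the role of the loop invariant. *)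
Lemma tr_while e p b T (L : nat -> seq nat) f :
  (forall i, i < b -> evl (L i) e != 0) -> evl (L b) e = 0 ->
  (forall i, i < b -> tr p (L i) T (L i.+1) (f i)) ->
  tr (While e p) (L 0) (b * (ecost e + T).+1 + (ecost e).+1) (L b) (catmap f b).
Proof.
move=> e_neq0 e_eq0 body; rewrite /catmap.
suff H d i : i + d = b -> tr (While e p) (L i) (d * (ecost e + T).+1 + (ecost e).+1)
    (L b) (flatten [seq f j | j <- iota i d]) by exact: H.
elim: d i => [|d IH] i ib s rs ms.
  rewrite addn0 in ib; subst i.
  exists (ecost e).+1, s; split=> //; last by rewrite /= cats0.
  by apply: ExecWhileF; rewrite (eval_evl e rs ms).
have lt_i : i < b by lia.
have [t [s1 [e1 le1 rs1 ms1 os1]]] := body i lt_i s rs ms.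
have [|t' [s2 [e2 le2 rs2 ms2 os2]]] := IH i.+1 _ s1 rs1 ms1; first by lia.
exists (ecost e + t + t').+1, s2; split=> //.
- by apply: ExecWhileT e1 e2; rewrite (eval_evl e rs ms) e_neq0.
- by move: le1 le2; lia.
- by rewrite os2 os1 /= catA.
Qed.

(** The counter is not initialised: it has to be 0 on entry, and it is reset to 0 on exit. *)
Definition For (r : nat) (e : expr) (body : cmd) : cmd :=
  Seq (While (Defs.Sub e (Reg r)) (Seq body (Set_ r (Add (Reg r) (Const 1)))))
      (Set_ r (Const 0)).

Definition Doubling (r : nat) (e : expr) (body : cmd) : cmd :=
  Seq (Set_ r (Const 1))
    (Seq (While (Defs.Sub e (Reg r)) (Seq body (Set_ r (Add (Reg r) (Reg r)))))
      (Set_ r (Const 0))).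

Section Loops.
Variables (r : nat) (e : expr) (body : cmd) (L : nat -> seq nat).
Variables (b T : nat) (f : nat -> seq nat).
Hypotheses (nthL : forall v, nth 0 (L v) r = v).
Hypotheses (setL : forall v v', set_nth 0 (L v) r v' = L v').
Hypotheses (evlL : forall v, evl (L v) e = b).

(** The bound [u] replaces the exact trip count, so that the time of nested loops depends on [u]
    alone. *)
Lemma tr_for u : b <= u ->
  (forall i, i < b -> tr body (L i) T (L i) (f i)) ->
  tr (For r e body) (L 0) (u * (ecost e + T + 7) + ecost e + 5) (L 0) (catmap f b).
Proof.
move=> le_u Hbody; apply: tr_le.
  apply: tr_seqr0; last first.
    by have := @tr_set r (Const 0) (L b); rewrite setL; apply.
  apply: (@tr_while _ _ b (T + 4) L) => [i lt_i||i lt_i].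
  - by have := evlL i; rewrite /evl /= nthL => ->; lia.
  - by have := evlL b; rewrite /evl /= nthL => ->; lia.
  apply: tr_seqr0 (Hbody i lt_i) _.
  by have := @tr_set r (Add (Reg r) (Const 1)) (L i); rewrite setL /evl /= nthL (addn1 i).
have := leq_mul le_u (leqnn (ecost e + T + 7)); rewrite /=; lia.
Qed.

(** [2 ^ a < b] holds exactly for [a < up_log 2 b], which is thus the trip count; the time bounds it
    crudely by [u]. *)
Lemma tr_doubling u : b <= u ->
  (forall a, a < up_log 2 b -> tr body (L (2 ^ a)) T (L (2 ^ a)) (f a)) ->
  tr (Doubling r e body) (L 0) (u * (ecost e + T + 7) + ecost e + 7) (L 0)
    (catmap f (up_log 2 b)).
Proof.
move=> le_u Hbody; apply: tr_le.
  apply: tr_seq0; first by have := @tr_set r (Const 1) (L 0); rewrite setL; apply.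
  apply: tr_seqr0; last first.
    by have := @tr_set r (Const 0) (L (2 ^ up_log 2 b)); rewrite setL; apply.
  apply: (@tr_while _ _ (up_log 2 b) (T + 4) (fun a => L (2 ^ a))) => [i lt_i||i lt_i].
  - have := evlL (2 ^ i); rewrite /evl /= nthL => ->; rewrite subn_eq0 -ltnNge.
    by rewrite ltnNge; apply: contraL lt_i => /up_log_min-/(_ isT); rewrite -leqNgt.
  - have := evlL (2 ^ up_log 2 b); rewrite /evl /= nthL => ->.
    by apply/eqP; rewrite subn_eq0 up_logP.
  apply: tr_seqr0 (Hbody i lt_i) _.
  have := @tr_set r (Add (Reg r) (Reg r)) (L (2 ^ i)).
  by rewrite setL /evl /= nthL (addnn (2 ^ i)) -mul2n -expnS.
have le_b : up_log 2 b <= b by apply: up_log_min => //; apply/ltnW/ltn_expl.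
have := leq_mul (leq_trans le_b le_u) (leqnn (ecost e + T + 7)); rewrite /=; lia.
Qed.

End Loops.

(** * The program *)

Local Notation "p ;; q" := (Seq p q) (at level 60, right associativity).
Local Notation rN := 0 (only parsing).
Local Notation rX := 1 (only parsing).
Local Notation rM := 2 (only parsing).
Local Notation rY := 3 (only parsing).
Local Notation rJ := 4 (only parsing).
Local Notation rI := 5 (only parsing).
Local Notation rSide := 6 (only parsing).
Local Notation rSb := 7 (only parsing).
Local Notation rSa := 8 (only parsing).
Local Notation rV := 9 (only parsing).
Local Notation rW := 10 (only parsing).
Local Notation rP := 11 (only parsing).
Local Notation rD := 12 (only parsing).
Local Notation rCnt := 13 (only parsing).
Local Notation rSq := 14 (only parsing).
Local Notation rAcc := 15 (only parsing).
Local Notation rEnd := 16 (only parsing).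

(* Every routine restores its scratch registers to 0, so that the register file
   after each command is an explicit list. *)
Definition Mod : cmd :=
  While (Defs.Sub (Add (Reg rX) (Const 1)) (Reg rM))
    (Set_ rX (Defs.Sub (Reg rX) (Reg rM))).

Definition Mul : cmd :=
  While (Reg rM)
    (Set_ rY (Add (Reg rY) (Reg rX));; Set_ rM (Defs.Sub (Reg rM) (Const 1)));;
  Set_ rX (Const 0).

(** Truncated subtraction makes [1 - (w - x)] the truth value of [w <= x]. The result is the
    negation of [matches], so that a conjunction can be printed as [1 - (y + x)]. *)
Definition Mismatch (ri rw rs : nat) : cmd :=
  Set_ rX (Reg ri);; Set_ rM (Reg rP);; Mod;;
  Set_ rM (Add (Reg rw) (Reg rw));; Mod;;
  Set_ rX (Add (Add (Defs.Sub (Const 1) (Defs.Sub (Reg rw) (Reg rX))) (Reg rs))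
    (Reg rSide));;
  Set_ rM (Const 2);; Mod.

Definition PrintCell : cmd :=
  Mismatch rI rW rSa;; Set_ rY (Reg rX);; Mismatch rJ rV rSb;;
  Print (Defs.Sub (Const 1) (Add (Reg rY) (Reg rX)));;
  Set_ rX (Const 0);; Set_ rM (Const 0);; Set_ rY (Const 0).

Definition PrintRect : cmd :=
  For rSide (Const 2) (For rI (Reg rN) (For rJ (Reg rN) PrintCell)).

Definition PrintBlock : cmd :=
  Doubling rW (Reg rP) (Doubling rV (Reg rP)
    (For rSa (Const 2) (For rSb (Const 2) PrintRect))).

(** Trial division: [1 - p %% d] is 1 exactly when [d] divides [p]. *)
Definition CountDivisors : cmd :=
  Set_ rD (Const 2);;
  While (Defs.Sub (Reg rP) (Reg rD))
    (Set_ rX (Reg rP);; Set_ rM (Reg rD);; Mod;;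
     Set_ rCnt (Add (Reg rCnt) (Defs.Sub (Const 1) (Reg rX)));;
     Set_ rX (Const 0);; Set_ rM (Const 0);;
     Set_ rD (Add (Reg rD) (Const 1)));;
  Set_ rD (Const 0).

Definition Candidate : cmd :=
  If (Defs.Sub (Reg rSq) (Reg rAcc))
    (CountDivisors;;
     If (Reg rCnt) (Set_ rCnt (Const 0))
       (PrintBlock;; Set_ rX (Reg rAcc);; Set_ rM (Reg rP);; Mul;;
        Set_ rAcc (Reg rY);; Set_ rY (Const 0)))
    Skip.

Definition Main : cmd :=
  Set_ rX (Reg rN);; Set_ rM (Reg rN);; Mul;; Set_ rSq (Reg rY);; Set_ rY (Const 0);;
  Set_ rX (Reg rSq);; Set_ rM (Const 256);; Mul;;
  Set_ rEnd (Add (Reg rY) (Const 2));; Set_ rY (Const 0);;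
  Set_ rAcc (Const 1);; Set_ rP (Const 2);;
  While (Defs.Sub (Reg rEnd) (Reg rP)) (Candidate;; Set_ rP (Add (Reg rP) (Const 1))).

(** * Output and running time of the routines *)

Lemma tr_Mod n x m rest u : 0 < m -> x <= u ->
  tr Mod [:: n, x, m & rest] (u * 10 + 6) [:: n, x %% m, m & rest] [::].
Proof.
move=> m_gt0 x_le; apply: tr_le.
  rewrite -(catmap_nil nat (x %/ m)).
  have -> : x %% m = x - (x %/ m) * m by have := divn_eq x m; lia.
  have -> : [:: n, x, m & rest] = (fun i => [:: n, x - i * m, m & rest]) 0.
    by rewrite subn0.
  apply: (@tr_while _ _ (x %/ m) 4 (fun i => [:: n, x - i * m, m & rest])).
  (* The test [x + 1 - m] is nonzero exactly when [m <= x], whence [x %/ m] rounds. *)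
  - move=> i; rewrite leq_divRL // mulSn /evl /=; lia.
  - rewrite /evl /=; have := divn_eq x m; have := ltn_pmod x m_gt0; lia.
  - move=> i lt_i.
    have := @tr_set rX (Defs.Sub (Reg rX) (Reg rM)) [:: n, x - i * m, m & rest].
    by rewrite /evl /= -subnDA addnC -mulSn.
have := leq_div x m; rewrite /=; lia.
Qed.

Ltac step := eapply tr_seq0; [exact: tr_set|]; rewrite /evl /=.

(** The time depends on the second factor only, so the accumulated product, kept as first factor,
    needs no bound. *)
Lemma tr_Mul n x m rest u : m <= u ->
  tr Mul [:: n, x, m, 0 & rest] (u * 12 + 6) [:: n, 0, 0, x * m & rest] [::].
Proof.
move=> m_le; apply: tr_le.
  eapply tr_seq0.
    rewrite -(catmap_nil nat m).
    have -> : [:: n, x, m, 0 & rest] = (fun i => [:: n, x, m - i, x * i & rest]) 0.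
      by rewrite subn0 muln0.
    apply: (@tr_while _ _ m (4 + 4) (fun i => [:: n, x, m - i, x * i & rest]))
      => [i||i lt_i]; rewrite /evl /=; [by lia|by lia|].
    step; have -> : m - i.+1 = m - i - 1 by lia.
    by rewrite mulnS [x + _]addnC; exact: tr_set.
  rewrite /= subnn; exact: tr_set.
rewrite /=; lia.
Qed.

(** [tl] begins at register 4, hence the shifts by 4; its positions 7 and 2 are [rP] and [rSide]. *)
Lemma tr_Mismatch n x m y tl a b c u :
    let p := nth 0 tl 7 in let w := nth 0 tl b in let i := nth 0 tl a in
    let sign := nth 0 tl c in let side := nth 0 tl 2 in
    0 < p -> 0 < w -> i <= u -> sign <= 1 -> side <= 1 -> 3 <= u ->
  tr (Mismatch a.+4 b.+4 c.+4) [:: n, x, m, y & tl] (u * 30 + 38)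
    [:: n, nat_of_bool (~~ matches p w sign side i), 2, y & tl] [::].
Proof.
move=> p w i sign side p_gt0 w_gt0 i_le sign_le side_le u_ge.
apply: tr_le.
  do 2 step; apply: tr_seq0; first exact: (@tr_Mod _ _ _ _ u p_gt0 i_le).
  step; apply: tr_seq0; first apply: (@tr_Mod _ _ _ _ u).
  - by rewrite addn_gt0 w_gt0.
  - exact: leq_trans (leq_mod _ _) i_le.
  do 2 step; rewrite /matches negbK -modn2 -/p -/w -/i -/sign -/side.
  have <- : 1 - (w - (i %% p) %% (w + w)) = (w <= (i %% p) %% (w + w)) by lia.
  (* Bit, sign and side add up to at most 3, whence [3 <= u]. *)
  by apply: (@tr_Mod _ _ _ _ u) => //; lia.
rewrite /=; lia.
Qed.

Lemma tr_PrintCell n j i side sb sa v w p rest u :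
    0 < p -> 0 < v -> 0 < w -> i <= u -> j <= u ->
    sa <= 1 -> sb <= 1 -> side <= 1 -> 3 <= u ->
  let l := [:: n, 0, 0, 0, j, i, side, sb, sa, v, w, p & rest] in
  tr PrintCell l (u * 60 + 90) l [:: nat_of_bool (cell p w v sa sb side i j)].
Proof.
move=> p_gt0 v_gt0 w_gt0 i_le j_le sa_le sb_le side_le u_ge /=.
apply: tr_le.
  apply: tr_seq0; first by apply: (@tr_Mismatch _ _ _ _ _ 1 6 4 u).
  step; apply: tr_seq0; first by apply: (@tr_Mismatch _ _ _ _ _ 0 5 3 u).
  apply: tr_seqr0.
    have -> : nat_of_bool (cell p w v sa sb side i j) =
        1 - (~~ matches p w sa side i + ~~ matches p v sb side j).
      by rewrite /cell; case: matches; case: matches.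
    exact: tr_print.
  do 2 step; exact: tr_set.
rewrite /=; lia.
Qed.

(** The 1 is the cost of evaluating the loop bound, a constant or a register. *)
Definition for_time (u T : nat) : nat := u * (1 + T + 7) + 1 + 5.

Definition doubling_time (u T : nat) : nat := u * (1 + T + 7) + 1 + 7.

Definition rect_time (u : nat) : nat :=
  for_time u (for_time u (for_time u (u * 60 + 90))).

Definition block_time (u : nat) : nat :=
  doubling_time u (doubling_time u (for_time u (for_time u (rect_time u)))).

Lemma tr_PrintRect n sb sa v w p rest u :
    0 < p -> 0 < v -> 0 < w -> n <= u -> sa <= 1 -> sb <= 1 -> 3 <= u ->
  let l := [:: n, 0, 0, 0, 0, 0, 0, sb, sa, v, w, p & rest] in
  tr PrintRect l (rect_time u) l (rect_code n p w v sa sb).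
Proof.
move=> p_gt0 v_gt0 w_gt0 n_le sa_le sb_le u_ge /=.
apply: (@tr_for _ _ _ (fun side => [:: n, 0, 0, 0, 0, 0, side, sb, sa, v, w, p & rest]))
  => // [|side lt_side]; first by lia.
apply: (@tr_for _ _ _ (fun i => [:: n, 0, 0, 0, 0, i, side, sb, sa, v, w, p & rest]))
  => // i lt_i.
apply: (@tr_for _ _ _ (fun j => [:: n, 0, 0, 0, j, i, side, sb, sa, v, w, p & rest]))
  => // j lt_j.
by apply: tr_PrintCell => //; lia.
Qed.

Lemma tr_PrintBlock n p rest u :
    0 < p -> p <= u -> n <= u -> 3 <= u ->
  let l := [:: n, 0, 0, 0, 0, 0, 0, 0, 0, 0, 0, p & rest] in
  tr PrintBlock l (block_time u) l (prime_block (rect_code n p) p).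
Proof.
move=> p_gt0 p_le n_le u_ge /=.
apply: (@tr_doubling _ _ _ (fun w => [:: n, 0, 0, 0, 0, 0, 0, 0, 0, 0, w, p & rest]))
  => // a lt_a.
apply: (@tr_doubling _ _ _ (fun v => [:: n, 0, 0, 0, 0, 0, 0, 0, 0, v, 2 ^ a, p & rest]))
  => // b lt_b.
apply: (@tr_for _ _ _ (fun sa => [:: n, 0, 0, 0, 0, 0, 0, 0, sa, 2 ^ b, 2 ^ a, p & rest]))
  => // [|sa lt_sa]; first by lia.
apply: (@tr_for _ _ _
  (fun sb => [:: n, 0, 0, 0, 0, 0, 0, sb, sa, 2 ^ b, 2 ^ a, p & rest]))
  => // [|sb lt_sb]; first by lia.
by apply: tr_PrintRect; rewrite ?expn_gt0.
Qed.

(** Keeping [i] apart from [p] lets the partial counts serve as loop invariant. *)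
Definition proper_divisors (p i : nat) : nat := \sum_(j < i) (j.+2 %| p).

Lemma proper_divisors_eq0 i : (proper_divisors i.+2 i == 0) = prime i.+2.
Proof.
rewrite /proper_divisors sum_nat_eq0; apply/forallP/idP => [no_div|pr_p j].
  apply/primeP; split=> // d d_dvd; have d_le := dvdn_leq (isT : 0 < i.+2) d_dvd.
  case: d d_dvd d_le => [|[|d]]; rewrite ?dvd0n // => d_dvd.
  rewrite leq_eqVlt => /orP[/eqP->|lt_d]; first by rewrite eqxx orbT.
  by have := no_div (Ordinal (lt_d : d < i)); rewrite /= d_dvd.
rewrite implyTb eqb0; apply/negP => /(prime_nt_dvdP pr_p (isT : j.+2 != 1)).
by have := ltn_ord j; lia.
Qed.

Definition count_time (u : nat) : nat := u * (u * 10 + 28) + 8.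

Lemma tr_CountDivisors n i rest u : i.+2 <= u ->
  tr CountDivisors [:: n, 0, 0, 0, 0, 0, 0, 0, 0, 0, 0, i.+2, 0, 0 & rest]
    (count_time u)
    [:: n, 0, 0, 0, 0, 0, 0, 0, 0, 0, 0, i.+2, 0, proper_divisors i.+2 i & rest] [::].
Proof.
move=> i_le; apply: tr_le.
  step; pose L j := [:: n, 0, 0, 0, 0, 0, 0, 0, 0, 0, 0, i.+2, j.+2,
    proper_divisors i.+2 j & rest].
  have -> : [:: n, 0, 0, 0, 0, 0, 0, 0, 0, 0, 0, i.+2, 2, 0 & rest] = L 0.
    by rewrite /L /proper_divisors big_ord0.
  apply: (@tr_seq0 _ _ _ _ _ (L i)); last exact: tr_set.
  rewrite -(catmap_nil nat i).
  apply: (@tr_while _ _ i (u * 10 + 24) L) => [j lt_j||j lt_j]; rewrite /evl /=.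
  - by lia.
  - by lia.
  apply: tr_le.
    do 2 step; apply: tr_seq0; first by apply: (@tr_Mod _ _ _ _ u).
    do 3 step; rewrite /L /proper_divisors big_ord_recr /=.
    have <- : 1 - i.+2 %% j.+2 = (j.+2 %| i.+2) by rewrite /dvdn; case: (_ %% _).
    by rewrite -[j.+3]addn1; exact: tr_set.
  rewrite /=; lia.
rewrite /count_time /=.
have : i <= u by lia.
move=> /leq_mul/(_ (leqnn (u * 10 + 28))); lia.
Qed.

Definition candidate_time (u : nat) : nat :=
  count_time u + block_time u + u * 12 + 30.

(** The registers just before the candidate [i + 2] is tested. *)
Definition sweep (n i : nat) : seq nat :=
  [:: n, 0, 0, 0, 0, 0, 0, 0, 0, 0, 0, i.+2, 0, 0, n * n, accum n i
    & [:: (candidates n).+2]].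

Lemma tr_Candidate n i u :
    i.+2 <= u -> n <= u -> 3 <= u ->
  tr Candidate (sweep n i) (candidate_time u)
    [:: n, 0, 0, 0, 0, 0, 0, 0, 0, 0, 0, i.+2, 0, 0, n * n, accum n i.+1
      & [:: (candidates n).+2]]
    (if selected n i then prime_block (rect_code n i.+2) i.+2 else [::]).
Proof.
move=> i_le n_le u_ge; rewrite /sweep /selected [accum n i.+1]/=.
have [lt_acc|ge_acc] /= := ltnP (accum n i) (n * n); last first.
  apply: tr_le.
    by apply: tr_ifF; [rewrite /evl /=; lia | exact: tr_skip].
  by rewrite /candidate_time /=; lia.
apply: tr_le.
  apply: tr_ifT; first by rewrite /evl /=; lia.
  apply: tr_seq0; first exact: tr_CountDivisors i_le.
  instantiate (1 := block_time u + u * 12 + 20).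
  have [pr|npr] := boolP (prime i.+2).
    have /eqP div0 : proper_divisors i.+2 i == 0 by rewrite proper_divisors_eq0.
    apply: tr_le.
      apply: tr_ifF; first by rewrite /evl /= div0.
      rewrite div0; apply: tr_seqr0.
        exact: (@tr_PrintBlock n i.+2 _ u).
      do 2 step; apply: tr_seq0; first exact: (@tr_Mul _ _ _ _ u).
      step; exact: tr_set.
    by rewrite /=; lia.
  have div0 : proper_divisors i.+2 i != 0 by rewrite proper_divisors_eq0.
  apply: tr_le.
    by apply: tr_ifT => //; exact: tr_set.
  by rewrite /=; lia.
by rewrite /candidate_time /=; lia.
Qed.

(** A single [u] above [n], every candidate and the factor 256, for use in all the time bounds. *)
Definition size_bound (n : nat) : nat := n * n * 256 + n + 256.

Definition main_time (u : nat) : nat := u * (candidate_time u + 8) + u * 24 + 60.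

Lemma tr_Main n :
  tr Main [:: n, 0, 0, 0, 0, 0, 0, 0, 0, 0, 0, 0, 0, 0, 0, 0 & [:: 0]]
    (main_time (size_bound n)) (sweep n (candidates n)) (blocks n (rect_code n)).
Proof.
set u := size_bound n.
have n_le : n <= u by rewrite /u /size_bound; lia.
have c_le : 256 <= u by rewrite /u /size_bound; lia.
have cand_le : candidates n + 2 <= u by rewrite /u /size_bound /candidates; lia.
apply: tr_le.
  do 2 step; apply: tr_seq0; first exact: (@tr_Mul _ _ _ _ u).
  do 4 step; apply: tr_seq0; first exact: (@tr_Mul _ _ _ _ u).
  do 4 step; rewrite addn2 -/(candidates n) -/(sweep n 0).
  apply: (@tr_while _ _ (candidates n) (candidate_time u + 4) (sweep n)).
  - by move=> i; rewrite /evl /=; lia.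
  - by rewrite /evl /=; lia.
  move=> i lt_i; apply: tr_seqr0; first by apply: tr_Candidate => //; lia.
  rewrite /sweep -[i.+3]addn1; exact: tr_set.
have /leq_mul/(_ (leqnn (candidate_time u + 8))) : candidates n <= u by lia.
rewrite /main_time /=; lia.
Qed.

(** * Polynomial bound on the running time *)

Definition poly_bounded (f : nat -> nat) : Prop :=
  exists q : {poly nat}, forall n, f n <= q.[n]%R.

Lemma poly_bounded_cst c : poly_bounded (fun=> c).
Proof. by exists c%:P%R => n; rewrite hornerC. Qed.

Lemma poly_bounded_id : poly_bounded id.
Proof. by exists 'X%R => n; rewrite hornerX. Qed.

Lemma poly_boundedD f g :
  poly_bounded f -> poly_bounded g -> poly_bounded (fun n => f n + g n).
Proof.
move=> [q Hq] [r Hr]; exists (q + r)%R => n.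
by rewrite hornerD; apply: leq_add.
Qed.

Lemma poly_boundedM f g :
  poly_bounded f -> poly_bounded g -> poly_bounded (fun n => f n * g n).
Proof.
move=> [q Hq] [r Hr]; exists (q * r)%R => n.
by rewrite hornerM; apply: leq_mul.
Qed.

Lemma poly_bounded_main_time : poly_bounded (fun n => main_time (size_bound n)).
Proof.
rewrite /main_time /candidate_time /count_time /block_time /rect_time.
rewrite /doubling_time /for_time.
have u_poly : poly_bounded size_bound.
  by rewrite /size_bound; do ![apply: poly_boundedD | apply: poly_boundedM
    | exact: poly_bounded_id | exact: poly_bounded_cst].
by do ![exact: u_poly | apply: poly_boundedD | apply: poly_boundedM
  | exact: poly_bounded_cst].
Qed.

Lemma blocks_poly_time : poly_time_computable (fun n => blocks n (rect_code n)).
Proof.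
have [q Hq] := poly_bounded_main_time; exists Main, q => n.
have [||t [s [Hexec le_t _ _ out]]] := @tr_Main n (init n).
(* Registers beyond the 17 listed ones read as the default 0 of [nth]. *)
- by rewrite /init /upd => r /=; do 17 case: r => [|r] //=; rewrite nth_nil.
- by [].
by exists t, s; split=> //; apply: leq_trans (Hq n).
Qed.

(** * The cover *)

Lemma catmapS (T : Type) (f : nat -> seq T) m : catmap f m.+1 = catmap f m ++ f m.
Proof. by rewrite /catmap -addn1 iotaD map_cat flatten_cat /= cats0. Qed.

Lemma eq_catmap (T : Type) (f g : nat -> seq T) m : f =1 g -> catmap f m = catmap g m.
Proof. by move=> fg; rewrite /catmap (eq_map fg). Qed.

Lemma mem_catmap (T : eqType) (f : nat -> seq T) m x :
  reflect (exists2 i, i < m & x \in f i) (x \in catmap f m).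
Proof.
apply: (iffP flattenP) => [[s /mapP[i + ->]]|[i lt_i x_in]].
  by rewrite mem_iota => lt_i x_in; exists i.
by exists (f i) => //; apply: map_f; rewrite mem_iota.
Qed.

Lemma size_catmap (T : Type) (f : nat -> seq T) m c :
  (forall i, size (f i) = c) -> size (catmap f m) = m * c.
Proof.
by move=> sz; elim: m => // m IH; rewrite catmapS size_cat IH sz mulSn addnC.
Qed.

(** The double loop visits the pairs in the order of the index [i * n + j], the one used by the
    Kronecker product. *)
Lemma catmap_grid (f : nat -> nat -> nat) m n :
  catmap (fun i => catmap (fun j => [:: f i j]) n) m =
  [seq f (v %/ n) (v %% n) | v <- iota 0 (m * n)].
Proof.
elim: m => // m IH; rewrite catmapS IH mulSn addnC iotaD map_cat add0n; congr (_ ++ _).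
rewrite -[X in iota X n]addn0 iotaDl -map_comp /catmap.
have : {in iota 0 n, forall j, j < n} by move=> j; rewrite mem_iota.
elim: (iota 0 n) => //= j s IHs lt_s; rewrite IHs; last first.
  by move=> j' sj'; apply: lt_s; rewrite inE sj' orbT.
have lt_j : j < n by apply: lt_s; rewrite mem_head.
by rewrite divnMDl ?modnMDl ?divn_small ?modn_small ?addn0 // (leq_ltn_trans _ lt_j).
Qed.

Lemma encode_catmap m n (f : nat -> seq (rectangle m n)) b :
  encode_cover (catmap f b) = catmap (fun i => encode_cover (f i)) b.
Proof.
elim: b => // b IH; rewrite !catmapS -IH /encode_cover.
by rewrite map_cat flatten_cat.
Qed.

Definition rect (n p w w' sa sb : nat) : rectangle (n * n) (n * n) :=
  ([set v : 'I_(n * n) | cell p w w' sa sb 0 (v %/ n) (v %% n)],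
   [set v : 'I_(n * n) | cell p w w' sa sb 1 (v %/ n) (v %% n)]).

Definition cover (n : nat) : seq (rectangle (n * n) (n * n)) :=
  blocks n (fun p w w' sa sb => [:: rect n p w w' sa sb]).

Lemma encode_grid n (f : nat -> nat -> bool) :
  encode_set [set v : 'I_(n * n) | f (v %/ n) (v %% n)] =
  catmap (fun i => catmap (fun j => [:: nat_of_bool (f i j)]) n) n.
Proof.
rewrite catmap_grid -val_enum_ord -map_comp; apply: eq_map => v.
by rewrite inE.
Qed.

(** Both sides are the same nest of loops, through which the encoding is pushed level by level. *)
Lemma encode_coverE n : encode_cover (cover n) = blocks n (rect_code n).
Proof.
rewrite /cover /blocks encode_catmap; apply: eq_catmap => i.
case: ifP => // _; rewrite /prime_block.
rewrite encode_catmap; apply: eq_catmap => a.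
rewrite encode_catmap; apply: eq_catmap => b.
rewrite encode_catmap; apply: eq_catmap => sa.
rewrite encode_catmap; apply: eq_catmap => sb.
rewrite /encode_cover /rect_code /= cats0 !encode_grid.
by rewrite !catmapS.
Qed.

Lemma Cmx_tensE n (v v' : 'I_(n * n)) :
  ((Cmx n *t Cmx n) v v' == 1)%R = (v %/ n != v' %/ n) && (v %% n != v' %% n).
Proof.
rewrite !mxE -!(inj_eq val_inj) /=.
by case: (v %/ n == v' %/ n); case: (v %% n == v' %% n).
Qed.

Lemma matches1 p w s i : matches p w s 1 i = ~~ matches p w s 0 i.
Proof. by rewrite /matches addn0 addn1. Qed.

(** If all these bits agree, then [x] and [y] agree modulo every [2 ^ e] with [e <= up_log 2 p], by
    induction on [e]; the last modulus exceeds both. *)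
Lemma bits_separate p x y : x < p -> y < p -> x != y ->
  exists2 a, a < up_log 2 p &
    (2 ^ a <= x %% (2 ^ a + 2 ^ a)) != (2 ^ a <= y %% (2 ^ a + 2 ^ a)).
Proof.
move=> lt_x lt_y neq_xy.
pose P a := (2 ^ a <= x %% (2 ^ a + 2 ^ a)) != (2 ^ a <= y %% (2 ^ a + 2 ^ a)).
have [/hasP[a]|no_bit] := boolP (has P (iota 0 (up_log 2 p))).
  by rewrite mem_iota => lt_a Pa; exists a.
have eq_bit a : a < up_log 2 p ->
    (2 ^ a <= x %% (2 ^ a + 2 ^ a)) = (2 ^ a <= y %% (2 ^ a + 2 ^ a)).
  move=> lt_a; have := hasPn no_bit a; rewrite mem_iota => /(_ lt_a).
  by rewrite /P negbK => /eqP.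
have le_p := up_logP p (isT : 1 < 2).
suff H e : e <= up_log 2 p -> x %% 2 ^ e = y %% 2 ^ e.
  have := H _ (leqnn _); rewrite !modn_small ?(leq_trans _ le_p) //.
  by move/eqP; rewrite (negPf neq_xy).
elim: e => [|e IH] lt_e; first by rewrite expn0 !modn1.
have bitE z : z %% (2 ^ e + 2 ^ e) =
    z %% 2 ^ e + (2 ^ e <= z %% (2 ^ e + 2 ^ e)) * 2 ^ e.
  have dvd_e : 2 ^ e %| 2 ^ e + 2 ^ e by rewrite dvdn_addr.
  rewrite -(modn_dvdm z dvd_e); set z' := z %% _.
  have : z' < 2 ^ e + 2 ^ e by rewrite ltn_mod addn_gt0 expn_gt0.
  case: (leqP (2 ^ e) z') => [le_z lt_z|lt_z _]; last by rewrite modn_small ?mul0n ?addn0.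
  rewrite -{2}(subnK le_z) modnDr modn_small; lia.
by rewrite expnS mul2n -addnn bitE [RHS]bitE IH ?eq_bit // ltnW.
Qed.

(** * The product of the selected primes *)

Lemma accum_gt0 n i : 0 < accum n i.
Proof. by elim: i => //= i IH; case: ifP => // _; rewrite muln_gt0 IH. Qed.

Lemma leq_accumS n i : accum n i <= accum n i.+1.
Proof. by rewrite /=; case: ifP => // _; rewrite leq_pmulr. Qed.

Lemma coprime_accum n i p : prime p -> i.+2 <= p -> coprime (accum n i) p.
Proof.
move=> pr_p; elim: i => [|i IH] le_p; first exact: coprime1n.
rewrite /=; case: ifP => [/andP[_ pr_i]|_]; last by apply: IH; lia.
rewrite coprimeMl IH ?(ltnW le_p) //= prime_coprime // dvdn_prime2 //.
by rewrite neq_ltn le_p.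
Qed.

(** The selected primes are distinct, so each new one is coprime to the product so far. *)
Lemma accum_dvd n m D :
  (forall i, i < m -> selected n i -> i.+2 %| D) -> accum n m %| D.
Proof.
elim: m => [|m IH] dvdD; first exact: dvd1n.
have dvd_m : accum n m %| D by apply: IH => i lt_i; apply: dvdD; lia.
rewrite /= -/(selected n m); case: ifP => // sel; rewrite Gauss_dvd.
  by rewrite dvd_m dvdD.
by case/andP: sel => _ pr; apply: coprime_accum.
Qed.

Lemma primorialS M : 0 < M ->
  primorial M.+1 = primorial M * (if prime M.+1 then M.+1 else 1).
Proof. by move=> M_gt0; rewrite /primorial big_mkcond big_nat_recr // -big_mkcond. Qed.

Lemma leq_primorial M M' : 0 < M -> M <= M' -> primorial M <= primorial M'.
Proof.
move=> M_gt0 /subnK <-; elim: (M' - M) => // d IH.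
rewrite addSn primorialS ?addn_gt0 ?M_gt0 ?orbT // (leq_trans IH) //.
by rewrite leq_pmulr //; case: ifP.
Qed.

(** Below the threshold no prime has been skipped. *)
Lemma accum_small n i : accum n i < n * n -> accum n i = primorial i.+1.
Proof.
elim: i => [|i IH] lt_acc; first by rewrite /primorial big_geq.
have lt_i := leq_ltn_trans (leq_accumS n i) lt_acc.
rewrite primorialS //= lt_i -IH //=.
by case: ifP => //; rewrite muln1.
Qed.

(** Past this size the primorial is at least [2 ^ (2 * k) >= n ^ 2], so selection has stopped. It is
    applied with [k = n] to bound the sweep and with the Boolean rank to bound the cover. *)
Lemma candidate_le n k i :
  n <= 2 ^ k -> accum n i < n * n -> i.+2 <= 2 ^ prime_exp k.
Proof.
move=> n_le lt_acc; rewrite ltnNge; apply/negP => le_i.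
have := leq_trans (primorial_ge k) (leq_primorial _ le_i).
rewrite expn_gt0 -(accum_small lt_acc) => /(_ isT); rewrite leqNgt.
by rewrite (leq_trans lt_acc) // mulnC expnM -mulnn leq_mul.
Qed.

Lemma accum_candidates n : n * n <= accum n (candidates n).
Proof.
case: n => // n; rewrite leqNgt; apply/negP.
(* Here [k] is [n] itself, by [n <= 2 ^ n]. *)
move/(candidate_le (ltnW (ltn_expl n.+1 (isT : 1 < 2)))).
have := prime_exp_le (isT : 0 < n.+1); rewrite /candidates -mulnn; lia.
Qed.

(** The last factor is at most [2 ^ prime_exp k] and multiplies a product still below [n ^ 2]. *)
Lemma accum_le n k i : n <= 2 ^ k -> accum n i <= 2 ^ (2 * k + prime_exp k).
Proof.
move=> n_le; elim: i => [|i IH] /=; first by rewrite expn_gt0.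
case: ifP => // /andP[lt_acc _]; rewrite expnD leq_mul ?(candidate_le n_le) //.
by rewrite (leq_trans (ltnW lt_acc)) // mulnC expnM -mulnn leq_mul.
Qed.

(** Otherwise the product of the selected primes, at least [n ^ 2], would divide
    [d * d' < n ^ 2]. *)
Lemma exists_separating_prime n d d' :
  0 < d < n -> 0 < d' < n ->
  exists i, [/\ i < candidates n, selected n i, ~~ (i.+2 %| d) & ~~ (i.+2 %| d')].
Proof.
move=> /andP[d_gt0 lt_d] /andP[d'_gt0 lt_d'].
pose P i := [&& selected n i, ~~ (i.+2 %| d) & ~~ (i.+2 %| d')].
have [/hasP[i]|no_sep] := boolP (has P (iota 0 (candidates n))).
  by rewrite mem_iota => /andP[_ lt_i] /and3P[]; exists i.
have : accum n (candidates n) %| d * d'.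
  apply: accum_dvd => i lt_i sel.
  have := hasPn no_sep i; rewrite mem_iota add0n => /(_ lt_i).
  rewrite /P sel /= negb_and !negbK => /orP[] dvd; first exact: dvdn_mulr.
  exact: dvdn_mull.
move/dvdn_leq; rewrite muln_gt0 d_gt0 d'_gt0 => /(_ isT).
by move/(leq_trans (accum_candidates n)); rewrite leqNgt ltn_mul.
Qed.

(** With truncated subtraction, the sum is the distance of [i] and [j]. *)
Lemma modn_neq i j p : ~~ (p %| (i - j) + (j - i)) -> i %% p != j %% p.
Proof.
apply: contra => eq_mod; case: (leqP i j) => [le_ij|/ltnW le_ji].
  move: le_ij (le_ij); rewrite -{1}subn_eq0 => /eqP-> le_ij.
  by rewrite -eqn_mod_dvd // eq_sym.
by move: le_ji (le_ji); rewrite -{1}subn_eq0 => /eqP-> le_ji; rewrite addn0 -eqn_mod_dvd.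
Qed.

Lemma matches_sign p w i : matches p w (w <= i %% p %% (w + w)) 0 i.
Proof. by rewrite /matches addn0 addnn odd_double. Qed.

Lemma cover_is_cover n : is_cover (Cmx n *t Cmx n) (cover n).
Proof.
have ones_cover r : r \in cover n -> all_ones (Cmx n *t Cmx n) r.
  case/mem_catmap => i _; case: ifP => // _.
  case/mem_catmap => a _ /mem_catmap[b _ /mem_catmap[sa _ /mem_catmap[sb _]]].
  rewrite inE => /eqP->; apply/forall_inP => -[v v'] /=.
  rewrite !inE /= /cell !matches1 Cmx_tensE => /andP[/andP[m1 m2] /andP[m3 m4]].
  (* Equal coordinates would have to satisfy a bit condition and its negation. *)
  by apply/andP; split; apply/eqP => eq_v; rewrite eq_v ?m1 ?m2 in m1 m2 m3 m4;
    rewrite ?m1 ?m2 in m3 m4.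
apply/andP; split; first by apply/allP.
rewrite eqEsubset; apply/andP; split.
  apply/subsetP => vv; rewrite bigcup_seq => /bigcupP[r r_in vv_in].
  by rewrite inE; have /forall_inP := ones_cover r r_in; apply.
apply/subsetP => -[v v']; rewrite inE /= Cmx_tensE => /andP[neq1 neq2].
have n_gt0 : 0 < n.
  by have := leq_ltn_trans (leq0n v) (ltn_ord v); rewrite muln_gt0 => /andP[].
have dist_bound x y : x < n -> y < n -> x != y -> 0 < (x - y) + (y - x) < n by lia.
have lt_div (u : 'I_(n * n)) : u %/ n < n by rewrite ltn_divLR.
have [i [lt_i sel ndvd1 ndvd2]] :=
    exists_separating_prime (dist_bound _ _ (lt_div v) (lt_div v') neq1)
      (dist_bound _ _ (ltn_pmod v n_gt0) (ltn_pmod v' n_gt0) neq2).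
have lt_mod x : x %% i.+2 < i.+2 by rewrite ltn_mod.
have [a lt_a bit_a] := bits_separate (lt_mod _) (lt_mod _) (modn_neq ndvd1).
have [b lt_b bit_b] := bits_separate (lt_mod _) (lt_mod _) (modn_neq ndvd2).
(* The signs are the bits of the row index [v]; those of [v'] differ, which puts [v'] on the column
   side. *)
set sa := (X in X != _) in bit_a; set sb := (X in X != _) in bit_b.
rewrite bigcup_seq; apply/bigcupP; exists (rect n i.+2 (2 ^ a) (2 ^ b) sa sb).
  apply/mem_catmap; exists i => //; rewrite sel.
  apply/mem_catmap; exists a => //; apply/mem_catmap; exists b => //.
  apply/mem_catmap; exists sa; first by case: sa {bit_a}.
  by apply/mem_catmap; exists sb; [case: sb {bit_b} | rewrite inE].
rewrite !inE /= /cell !matches1 !matches_sign /=.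
rewrite /matches !addn0 !negbK !oddD !oddb.
by rewrite -!negb_eqb [_ == sa]eq_sym [_ == sb]eq_sym bit_a bit_b.
Qed.

(** * Size of the cover *)

Definition selected_bits n m := \sum_(i < m | selected n i) up_log 2 i.+2.

Lemma expn_up_log p : 1 < p -> 2 ^ up_log 2 p <= p ^ 2.
Proof.
move=> p_gt1; have := up_log_gtn (isT : 1 < 2) p_gt1.
have : 0 < up_log 2 p by rewrite up_log_gt0.
by case: (up_log 2 p) => // u _; rewrite expnS -mulnn /=; nia.
Qed.

Lemma expn_selected_bits n m : 2 ^ selected_bits n m <= accum n m ^ 2.
Proof.
rewrite /selected_bits; elim: m => [|m IH]; first by rewrite big_ord0.
rewrite big_mkcond big_ord_recr /= -big_mkcond /= -/(selected n m).
case: ifP => _; last by rewrite addn0.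
by rewrite expnD expnMn leq_mul // expn_up_log.
Qed.

Lemma size_prime_block T (f : nat -> nat -> nat -> nat -> T) p :
  size (prime_block (fun w w' sa sb => [:: f w w' sa sb]) p) = 4 * up_log 2 p ^ 2.
Proof.
rewrite /prime_block (@size_catmap _ _ _ (up_log 2 p * 4)); first by lia.
by move=> a; rewrite (@size_catmap _ _ _ 4) // => b; rewrite !(@size_catmap _ _ _ 2).
Qed.

(** Of the two factors [up_log 2 p] in each block, one is bounded by [prime_exp k]; the other is
    summed over the selected primes, using [2 ^ up_log 2 p <= p ^ 2] and the bound on their
    product. *)
Lemma size_cover n k : n <= 2 ^ k ->
  size (cover n) <= 4 * prime_exp k * (2 * (2 * k + prime_exp k)).
Proof.
move=> n_le; apply: (@leq_trans (4 * prime_exp k * selected_bits n (candidates n))).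
  rewrite /cover /blocks /selected_bits; elim: (candidates n) => // m IH.
  rewrite catmapS size_cat big_mkcond big_ord_recr /= -big_mkcond /= mulnDr leq_add //.
  case: ifP => // /andP[lt_acc _]; rewrite size_prime_block -mulnn mulnA leq_mul2r.
  rewrite leq_mul2l (up_log_min _ (candidate_le n_le lt_acc)) //.
  by rewrite !orbT.
rewrite leq_mul2l -(@leq_exp2l 2) //; apply/orP; right.
apply: leq_trans (expn_selected_bits _ _) _.
by rewrite mulnC expnM leq_exp2r // accum_le.
Qed.

(** 640 is [4 * 8 * 2 * 10], as [prime_exp k <= 8 * up_log 2 k] and
    [2 * k + prime_exp k <= 10 * k]. *)
Lemma size_cover_up_log n k : 2 <= k -> n <= 2 ^ k ->
  size (cover n) <= 640 * (k * up_log 2 k).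
Proof.
move=> k_ge2 /size_cover/leq_trans; apply; rewrite /prime_exp.
have : 0 < up_log 2 k by rewrite up_log_gt0.
have : up_log 2 k <= k by apply: up_log_min => //; apply/ltnW/ltn_expl.
nia.
Qed.

(** * Boolean rank *)

Lemma boolean_rank_cover m n (A : 'M[int]_(m, n)) :
  exists s : (boolean_rank A).-tuple (rectangle m n), is_cover A s.
Proof.
by rewrite /boolean_rank; case: ex_minnP => k /existsP[s cov_s] _; exists s.
Qed.

Section CoverCmx.
Variables (n k : nat) (s : k.-tuple (rectangle n n)).
Hypothesis cov_s : is_cover (Cmx n) s.

Lemma cover_offdiag (i j : 'I_n) : i != j ->
  exists2 t : 'I_k, i \in (tnth s t).1 & j \in (tnth s t).2.
Proof.
move=> neq_ij; have /andP[_ /eqP/setP/(_ (i, j))] := cov_s.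
rewrite [RHS]inE /= mxE neq_ij eqxx bigcup_seq => /bigcupP[r /tnthP[t ->]].
by rewrite inE /= => /andP[]; exists t.
Qed.

Lemma cover_diag (t : 'I_k) (i : 'I_n) :
  i \in (tnth s t).1 -> i \in (tnth s t).2 -> False.
Proof.
move=> i1 i2; have /andP[/allP/(_ (tnth s t) (mem_tnth _ _))/forall_inP ones _] := cov_s.
by have := ones (i, i); rewrite inE /= i1 i2 mxE eqxx => /(_ isT).
Qed.

(** If rows [i != j] lay in the same rectangles, the one covering [(i, j)] would contain the zero
    entry [(j, j)]. *)
Lemma cover_leq_expn : n <= 2 ^ k.
Proof.
pose F (i : 'I_n) := [set t : 'I_k | i \in (tnth s t).1].
have F_inj : injective F.
  move=> i j /setP eqF; apply/eqP/negPn/negP => /cover_offdiag[t i1 j2].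
  by have := eqF t; rewrite !inE i1 => /esym j1; apply: cover_diag j1 j2.
have := leq_card F F_inj; rewrite card_ord.
have -> : #|{set 'I_k}| = 2 ^ k; last by [].
by rewrite -cardsT -powersetT card_powerset cardsT card_ord.
Qed.

(** A rectangle containing both [(0, 1)] and [(1, 0)] would meet the diagonal. *)
Lemma cover_gt1 : 1 < n -> 1 < k.
Proof.
move=> n_gt1; pose i0 : 'I_n := Ordinal (ltnW n_gt1); pose i1 : 'I_n := Ordinal n_gt1.
have [t a b] : exists2 t : 'I_k, i0 \in (tnth s t).1 & i1 \in (tnth s t).2.
  exact: cover_offdiag.
have [t' a' b'] : exists2 t : 'I_k, i1 \in (tnth s t).1 & i0 \in (tnth s t).2.
  exact: cover_offdiag.
rewrite ltnNge; apply/negP => k_le1.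
have tt' : t = t' by apply: ord_inj; have := ltn_ord t; have := ltn_ord t'; lia.
by subst t'; apply: cover_diag a b'.
Qed.

End CoverCmx.

(** * Real logarithms and the final bound *)

Local Open Scope ring_scope.
Import Order.TTheory GRing.Theory Num.Theory.

(** Rounding up adds at most 1, and [log2 k >= 1] for [k >= 2]. *)
Lemma up_log_le_log2 (R : realType) (k : nat) :
  (2 <= k)%N -> (up_log 2 k)%:R <= 2 * log2 (k%:R : R).
Proof.
move=> k_ge2; have ln2_gt0 : 0 < ln (2 : R) by rewrite ln_gt0 // ltr1n.
rewrite /log2 mulrA ler_pdivlMr //.
have le2k : ln (2 : R) <= ln (k%:R : R).
  by rewrite ler_ln ?posrE ?ltr0n ?ler_nat // (leq_trans _ k_ge2).
have := up_log_gtn (isT : 1 < 2)%N k_ge2.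
have : (0 < up_log 2 k)%N by rewrite up_log_gt0.
case: (up_log 2 k) => // u _ /= lt_u.
have : ln (2 : R) *+ u <= ln (k%:R : R).
  rewrite -lnXn // -natrX ler_ln ?posrE ?ltr0n ?expn_gt0 ?ler_nat //.
    exact: ltnW.
  exact: leq_trans k_ge2.
by move=> le_u; rewrite -natr1 mulrDl mul1r !mulr_natl mulr2n lerD.
Qed.

(** The empty product 1 already reaches [n * n]. The Boolean rank is 0 here, so only an empty cover
    meets the size bound. *)
Lemma cover_small n : (n <= 1)%N -> cover n = [::].
Proof.
move=> n_le1; rewrite /cover /blocks /catmap.
elim: (iota _ _) => //= i s ->; rewrite /selected.
have acc_gt0 := accum_gt0 n i.
by rewrite ltnNge (leq_trans (leq_mul n_le1 n_le1) acc_gt0).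
Qed.

Theorem theorem6 (R : realType) :
  exists c : R, 0 < c /\
  exists cov : forall n : nat, seq (rectangle (n * n) (n * n)),
    poly_time_computable (fun n => encode_cover (cov n)) /\
    forall n : nat,
      let k := (boolean_rank (Cmx n))%:R : R in
      is_cover (Cmx n *t Cmx n) (cov n) /\
      (size (cov n))%:R <= c * (k * log2 k).
Proof.
(* The factor 2 pays for replacing [up_log 2 k] by [log2 k]. *)
exists (640 * 2); split; first by rewrite mulr_gt0 ?ltr0n.
exists cover; split.
  have [p [q Hpq]] := blocks_poly_time; exists p, q => n.
  by rewrite encode_coverE; apply: Hpq.
move=> n; split; first exact: cover_is_cover.
have [s cov_s] := boolean_rank_cover (Cmx n).
move: (boolean_rank (Cmx n)) s cov_s => k s cov_s.
have [n_gt1|n_le1] := ltnP 1 n; last first.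
  rewrite (cover_small n_le1); apply: mulr_ge0; first by rewrite mulr_ge0 ?ler0n.
  have [->|k_gt0] := posnP k; first by rewrite mul0r.
  by rewrite mulr_ge0 ?ler0n // /log2 divr_ge0 // ln_ge0 // ler1n.
have k_gt1 := cover_gt1 cov_s n_gt1.
apply: le_trans (_ : (640 * (k * up_log 2 k))%N%:R <= _).
  by rewrite ler_nat size_cover_up_log // (cover_leq_expn cov_s).
rewrite natrM -mulrA ler_wpM2l ?ler0n //.
by rewrite natrM mulrCA ler_wpM2l ?ler0n // up_log_le_log2.
Qed.
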